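(* Let $\mathbb{K}\in\{\mathbb{R},\mathbb{C}\}$, let $\mathcal{X}$ be a separable topological $\mathbb{K}$-vector space whose topological dual $\mathcal{X}^{\ast}$ separates the points of $\mathcal{X}$, and let $\mathcal{U}$ be a $0$-neighborhood in $\mathcal{X}$ such that there exists an infinite set $\{\sigma_n\}_{n\in\mathbb{N}}$ of linearly independent elements of $\mathcal{X}^{\ast}$ with $\sup_{A\in\mathcal{U}}|\sigma_n(A)|<\infty$ for every $n$. Then $\mathcal{D}_{0,\mathcal{U}}$ (and hence $\mathcal{D}_{\mathcal{U}}\supseteq\mathcal{D}_{0,\mathcal{U}}$) is dense in $\mathbf{CU}_{\mathcal{U}}(\mathcal{X}^{\ast})$ with respect to the weak*-Hausdorff hypertopology.
   Context: Topological vector spaces are Hausdorff. $\mathcal{X}^{\ast}$ carries the weak* topology. $\mathcal{U}^{\circ}=\{\sigma\in\mathcal{X}^{\ast}:|\sigma(A)|\le1\ \forall A\in\mathcal{U}\}$; $\mathbf{CU}_{\mathcal{U}}(\mathcal{X}^{\ast})$ is the set of nonempty convex weak*-closed subsets of $\mathcal{U}^{\circ}$. For a convex set $C\subseteq\mathcal{X}^{\ast}$, $\mathcal{E}(C)$ is its set of extreme points, and a point $\sigma_0\in C$ is exposed if there is $A\in\mathcal{X}$ such that $\sigma\mapsto\mathrm{Re}\,\sigma(A)$ attains its maximum on $C$ uniquely at $\sigma_0$; $\mathcal{E}_0(C)$ is the set of exposed points. $\mathcal{D}_{\mathcal{U}}=\{U\in\mathbf{CU}_{\mathcal{U}}(\mathcal{X}^{\ast}):U=\overline{\mathcal{E}(U)}\}$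 and $\mathcal{D}_{0,\mathcal{U}}=\{U\in\mathbf{CU}_{\mathcal{U}}(\mathcal{X}^{\ast}):U=\overline{\mathcal{E}_0(U)}\}$ (weak*-closures). The weak*-Hausdorff hypertopology is generated by the extended pseudometrics $d_H^{(A)}(F,\tilde F)=\max\{\sup_{\sigma\in F}\inf_{\tilde\sigma\in\tilde F}|(\sigma-\tilde\sigma)(A)|,\ \sup_{\tilde\sigma\in\tilde F}\inf_{\sigma\in F}|(\sigma-\tilde\sigma)(A)|\}$, $A\in\mathcal{X}$. *)

(* Defs.v *)
From HB Require Import structures.
From mathcomp Require Import all_boot all_order all_algebra.
From mathcomp Require Import all_classical all_reals all_analysis.
From mathcomp Require Import complex.
Set Implicit Arguments. Unset Strict Implicit. Unset Printing Implicit Defensive.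
Import Order.TTheory GRing.Theory Num.Theory.
Import numFieldNormedType.Exports.
Local Open Scope classical_set_scope.
Local Open Scope ring_scope.

Section WeakStarHyper.
(* R : the reals; K : the scalar field (K = R or K = R[i]);
   re : K -> R is the real-part map (id for K = R, complex.Re for K = R[i]). *)
Context (R : realType) (K : numFieldType) (re : K -> R).
Context (X : topologicalLmodType K).

Definition dual : set (X -> K) :=
  [set s | (forall x y : X, s (x + y) = s x + s y) /\
           (forall (a : K) (x : X), s (a *: x) = a * s x) /\
           continuous s].

Definition separable : Prop :=
  exists D : set X, countable D /\ closure D = [set: X].

Definition dual_separates_points : Prop :=
  forall x y : X, x <> y -> exists s, dual s /\ s x <> s y.

Definition lin_indep_seq (sigma : nat -> X -> K) : Prop :=
  forall (n : nat) (c : nat -> K),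
    (forall x : X, \sum_(i < n) c i * sigma i x = 0) ->
    forall i : nat, (i < n)%N -> c i = 0.

Definition polar (U : set X) : set (X -> K) :=
  [set s | dual s /\ forall A, U A -> `|s A| <= 1].

(* convexity in X^star (scalars t in [0,1]; in K = R[i] this forces t real) *)
Definition convex_dual (C : set (X -> K)) : Prop :=
  forall s1 s2 (t : K), C s1 -> C s2 -> 0 <= t <= 1 ->
    C (fun x => t * s1 x + (1 - t) * s2 x).

(* weak-star-closure in X^star : s lies in the closure of S iff every basic
   weak-star-neighbourhood {t | |t(A_i) - s(A_i)| < e, i < n} of s meets S *)
Definition wclosure (S : set (X -> K)) : set (X -> K) :=
  [set s | dual s /\
     forall (n : nat) (A : nat -> X) (e : K), 0 < e ->
       exists t, S t /\ forall i, (i < n)%N -> `|t (A i) - s (A i)| < e].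

Definition wclosed (S : set (X -> K)) : Prop := wclosure S `<=` S.

Definition CU (U : set X) : set (set (X -> K)) :=
  [set C | C !=set0 /\ convex_dual C /\ wclosed C /\ C `<=` polar U].

Definition extreme (C : set (X -> K)) : set (X -> K) :=
  [set s | C s /\ forall s1 s2 (t : K), C s1 -> C s2 -> 0 < t < 1 ->
      s = (fun x => t * s1 x + (1 - t) * s2 x) -> s1 = s2].

Definition exposed (C : set (X -> K)) : set (X -> K) :=
  [set s | C s /\ exists A : X, forall t, C t -> t <> s -> re (t A) < re (s A)].

Definition DU (U : set X) : set (set (X -> K)) :=
  [set C | CU U C /\ C = wclosure (extreme C)].

Definition D0U (U : set X) : set (set (X -> K)) :=
  [set C | CU U C /\ C = wclosure (exposed C)].

Definition dH (A : X) (F G : set (X -> K)) : \bar R :=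
  maxe
    (ereal_sup [set ereal_inf [set (re `|(s A) - (t A)|)%:E | t in G] | s in F])
    (ereal_sup [set ereal_inf [set (re `|(s A) - (t A)|)%:E | s in F] | t in G]).

(* density of D in the family CU w.r.t. the topology generated by the
   extended pseudometrics dH A, A in X: every basic neighbourhood
   (finite intersection of dH-balls around C in CU) meets D *)
Definition hyper_dense (U : set X) (D : set (set (X -> K))) : Prop :=
  forall C, CU U C ->
    forall (n : nat) (A : nat -> X) (e : R), 0 < e ->
      exists C', D C' /\ forall i, (i < n)%N -> (dH (A i) C C' < e%:E)%E.

End WeakStarHyper.

(* Main.v *)
(** Choose finitely many points of [C] that form a net for the seminorms of
[A_0, ..., A_(n-1)], and a sequence [v_j] of functionals with a biorthogonal
sequence [B_j] of vectors, [v_i (B_j) = delta_ij], such that the net lies in the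
span of [v_j], [j < k], and the later [v_(k+m)] decay geometrically on [U].  In
the coordinates [s (B_j)], take the functionals whose head (coordinates below
[k]) is [1 - delta] times a point of [C] and whose coordinates lie in the
Hilbert ball of radius [kappa].  This convex set is weak*-closed, lies in the
polar of [U], and is close to [C].  A finitely supported point of the sphere of
radius [kappa] is exposed by a finite combination of the [B_j], because the
Hilbert ball is strictly convex.  Such points are weak*-dense: truncate the
coordinates and restore the norm with one far coordinate, on which [v] is small. *)
Require Import Defs.
From HB Require Import structures.
From mathcomp Require Import all_boot all_order all_algebra.
From mathcomp Require Import all_classical all_reals all_analysis.
From mathcomp Require Import complex ring lra.
Import Order.TTheory GRing.Theory Num.Theory.
Import numFieldNormedType.Exports.
Local Open Scope classical_set_scope.
Local Open Scope ring_scope.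
Set Implicit Arguments. Unset Strict Implicit. Unset Printing Implicit Defensive.

(** * The two scalar fields behind one interface *)

(* [K] is [R] or [R[i]]: [re] is the real part, [rho] the inclusion of [R], [cj]
   the conjugation; [re_polar] is the polarization identity for [Re (cj y * x)], and
   [tot_bounded] covers bounded sets by the finitely many small fibres of [q]. *)
Record scalars (R : realType) (K : numFieldType) (re : K -> R) (rho : R -> K)
    (cj : K -> K) : Prop := Scalars {
  rhoD : forall r s, rho (r + s) = rho r + rho s;
  rhoM : forall r s, rho (r * s) = rho r * rho s;
  rho1 : rho 1 = 1;
  ler_rho : forall r s, (rho r <= rho s) = (r <= s);
  reD : forall x y, re (x + y) = re x + re y;
  re_rhoM : forall r x, re (rho r * x) = r * re x;
  normE : forall x : K, `|x| = rho (re `|x|);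
  re_polar : forall x y : K,
    2 * re (cj y * x) = re `|x| ^+ 2 + re `|y| ^+ 2 - re `|x - y| ^+ 2;
  tot_bounded : forall M e : R, 0 < e -> exists (T : finType) (q : K -> T),
    forall x y : K, re `|x| <= M -> re `|y| <= M -> q x = q y -> re `|x - y| < e }.

(** The code is the index of the cell of length [e] containing [x + M]; points of one cell differ by
    less than [e]. The bound [M] keeps [inord] from altering the index. *)
Lemma real_codes (R : realType) (M e : R) : 0 < e ->
  exists n (q : R -> 'I_n.+1), forall x y, `|x| <= M -> `|y| <= M -> q x = q y ->
    `|x - y| < e.
Proof.
move=> e0; pose f (x : R) := Num.truncn ((x + M) / e).
exists (Num.truncn ((M + M) / e)), (fun x => inord (f x)) => x y xM yM.
have lt z : `|z| <= M -> (f z < (Num.truncn ((M + M) / e)).+1)%N.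
  move=> zM; rewrite ltnS; apply: le_truncn.
  by rewrite ler_pM2r ?invr_gt0// lerD2r (le_trans (ler_norm _)).
move/(congr1 val); rewrite /= !inordK ?lt// => fxy.
have itv z : `|z| <= M -> (f z)%:R * e <= z + M < (f z).+1%:R * e.
  move=> zM; rewrite -ler_pdivlMr// -ltr_pdivrMr//; apply: truncn_itv.
  by rewrite divr_ge0 ?(ltW e0)//; move: zM; rewrite ler_norml => /andP[]; lra.
have := itv _ xM; have := itv _ yM; rewrite fxy -natr1 mulrDl mul1r.
by move=> /andP[? ?] /andP[? ?]; rewrite ltr_norml; apply/andP; split; lra.
Qed.

Lemma scalarsR (R : realType) : scalars (@id R) id id.
Proof.
split=> //=.
- by move=> x y; rewrite !real_normK ?num_real//; ring.
- move=> M e /(real_codes M)[n [q h]]; by exists 'I_n.+1, q.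
Qed.

Lemma scalarsC (R : realType) :
  scalars (@complex.Re R) (@real_complex R) (@conjc R).
Proof.
have reN (z : R[i]) :
  complex.Re `|z| = Num.sqrt (complex.Re z ^+ 2 + complex.Im z ^+ 2) by case: z.
split.
- by move=> r s; rewrite rmorphD.
- by move=> r s; rewrite rmorphM.
- by [].
- by move=> r s; rewrite lecR.
- by move=> [? ?] [? ?].
- by move=> r [a b] /=; rewrite mul0r subr0.
- by case.
- move=> x y; rewrite !reN !sqr_sqrtr ?addr_ge0 ?sqr_ge0//.
  by case: x y => [a b] [c d] /=; ring.
- move=> M e e0.
  have [n [q hq]] := @real_codes R M (e / 2) (divr_gt0 e0 (ltr0n _ 2)).
  exists ('I_n.+1 * 'I_n.+1)%type, (fun z => (q (complex.Re z), q (complex.Im z))).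
  have reM (z : R[i]) : complex.Re `|z| <= M ->
    `|complex.Re z| <= M /\ `|complex.Im z| <= M.
    rewrite reN => zM; split; apply: le_trans zM;
      rewrite -sqrtr_sqr ler_sqrt ?addr_ge0 ?sqr_ge0// ?lerDl ?lerDr sqr_ge0//.
  move=> x y /reM[x1 x2] /reM[y1 y2] [/(hq _ _ x1 y1) h1 /(hq _ _ x2 y2) h2].
  rewrite reN. apply: (@le_lt_trans _ _ (`|complex.Re (x - y)| + `|complex.Im (x - y)|)).
    rewrite -[leRHS]ger0_norm ?addr_ge0// -[leRHS]sqrtr_sqr ler_sqrt ?sqr_ge0//.
    rewrite sqrrD !real_normK ?num_real// addrAC lerDl mulrn_wge0// mulr_ge0//.
  case: x y h1 h2 {x1 x2 y1 y2} => [a b] [c d] /=. lra.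
Qed.

(** * Real-valued modulus and order of the scalars *)

Section Scalars.
Context (R : realType) (K : numFieldType) (re : K -> R) (rho : R -> K)
  (cj : K -> K) (S : scalars re rho cj).
Local Notation nm z := (re `|z|).

Lemma rho0 : rho 0 = 0.
Proof. by have := rhoD S 0 0; rewrite addr0 => /(congr1 (fun z => z - rho 0));
  rewrite addrK subrr. Qed.

Lemma re0 : re 0 = 0.
Proof. by have := reD S 0 0; rewrite addr0 => /(congr1 (fun z => z - re 0));
  rewrite addrK subrr. Qed.

Lemma rhoB r s : rho (r - s) = rho r - rho s.
Proof. by apply: (addIr (rho s)); rewrite -(rhoD S) !subrK. Qed.

Lemma rho_inj : injective rho.
Proof. by move=> r s rs; apply/le_anti; rewrite -!(ler_rho S) rs lexx. Qed.

Lemma ltr_rho r s : (rho r < rho s) = (r < s).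
Proof. by rewrite !lt_neqAle (ler_rho S) (inj_eq rho_inj). Qed.

Lemma rho_ge0 r : (0 <= rho r) = (0 <= r).
Proof. by rewrite -rho0 (ler_rho S). Qed.

Lemma nm_ge0 (z : K) : 0 <= nm z.
Proof. by rewrite -rho_ge0 -(normE S). Qed.

Lemma nm_le r (z : K) : (`|z| <= rho r) = (nm z <= r).
Proof. by rewrite [X in X <= _](normE S) (ler_rho S). Qed.

Lemma nm_lt r (z : K) : (`|z| < rho r) = (nm z < r).
Proof. by rewrite [X in X < _](normE S) ltr_rho. Qed.

Lemma nmD (x y : K) : nm (x + y) <= nm x + nm y.
Proof. by rewrite -nm_le (rhoD S) -!(normE S) ler_normD. Qed.

Lemma nmN (x : K) : nm (- x) = nm x.
Proof. by rewrite normrN. Qed.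

Lemma nmB (x y : K) : nm (x - y) <= nm x + nm y.
Proof. by rewrite -(nmN y) nmD. Qed.

Lemma nmM (x y : K) : nm (x * y) = nm x * nm y.
Proof. by apply: rho_inj; rewrite (rhoM S) -!(normE S) normrM. Qed.

Lemma nm0 : nm (0 : K) = 0.
Proof. by rewrite normr0 re0. Qed.

Lemma nm_eq0 (z : K) : nm z = 0 -> z = 0.
Proof. by move=> z0; apply/normr0_eq0; rewrite (normE S) z0 rho0. Qed.

Lemma nm_rho r : 0 <= r -> nm (rho r) = r.
Proof. by move=> r0; apply: rho_inj; rewrite -(normE S) ger0_norm ?rho_ge0. Qed.

Lemma re_sum n (f : nat -> K) : re (\sum_(i < n) f i) = \sum_(i < n) re (f i).
Proof.
elim: n => [|n IH]; first by rewrite !big_ord0 re0.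
by rewrite !big_ord_recr /= (reD S) IH.
Qed.

(** A nonnegative element of [K] is its own modulus, hence real. *)
Lemma unit_interval_rho (t : K) : 0 <= t <= 1 -> exists2 r, 0 <= r <= 1 & t = rho r.
Proof.
move=> /andP[t0 t1]; have tE : t = rho (nm t) by rewrite -(normE S) ger0_norm.
exists (nm t) => //; rewrite -rho_ge0 -tE t0/=.
by rewrite -(ler_rho S) -tE (rho1 S).
Qed.

End Scalars.

Lemma geometric_small (R : realType) (M e : R) : 0 < e ->
  exists n0, forall n, (n0 <= n)%N -> M / 2 ^+ n < e.
Proof.
move=> e0; exists (Num.truncn (`|M| / e)).+1 => n n0n.
rewrite ltr_pdivrMr ?exprn_gt0// mulrC -ltr_pdivrMr//.
apply: le_lt_trans (_ : `|M| / e < _); first by rewrite ler_pM2r ?invr_gt0// ler_norm.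
apply: lt_le_trans (truncnS_gt _) _; rewrite -natrX ler_nat.
by rewrite (leq_trans n0n)// ltnW// ltn_expl.
Qed.

Lemma sum_support_le (R : realType) (f : nat -> R) N n :
  (forall j, 0 <= f j) -> (forall j, (N <= j)%N -> f j = 0) ->
  \sum_(j < n) f j <= \sum_(j < N) f j.
Proof.
move=> f0 fN; rewrite -!(big_mkord xpredT).
have [nN|/ltnW Nn] := leqP n N.
  by rewrite (big_cat_nat (leq0n n) nN) /= lerDl sumr_ge0.
rewrite (big_cat_nat (leq0n N) Nn) /= [X in _ + X <= _]big_nat_cond.
rewrite [X in _ + X <= _]big1 ?addr0//.
by move=> j /andP[/andP[/fN]].
Qed.

(** * Continuous functionals, the polar and its pointwise bounds *)

Section Dual.
Context (R : realType) (K : numFieldType) (re : K -> R) (rho : R -> K)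
  (cj : K -> K) (S : scalars re rho cj) (X : topologicalLmodType K).
Implicit Types (s t : X -> K) (U : set X) (C : set (X -> K)).
Local Notation nm z := (re `|z|).

Lemma dualD s x y : dual s -> s (x + y) = s x + s y.
Proof. by case. Qed.

Lemma dualZ s a x : dual s -> s (a *: x) = a * s x.
Proof. by move=> [_ []]. Qed.

Lemma dual0 s : dual s -> s 0 = 0.
Proof. by move=> ds; rewrite -(scale0r 0) dualZ// mul0r. Qed.

Lemma dualB s x y : dual s -> s (x - y) = s x - s y.
Proof. by move=> ds; rewrite dualD// -scaleN1r dualZ// mulN1r. Qed.

Lemma dual_sum s n (a : nat -> K) (x : nat -> X) : dual s ->
  s (\sum_(i < n) a i *: x i) = \sum_(i < n) a i * s (x i).
Proof.
move=> ds; elim: n => [|n IH]; first by rewrite !big_ord0 dual0.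
by rewrite !big_ord_recr /= dualD// dualZ// IH.
Qed.

Lemma dual_cst0 : dual (fun _ : X => 0 : K).
Proof. by split=> [*|]; rewrite ?addr0//; split=> [*|]; rewrite ?mulr0//;
  exact: cst_continuous. Qed.

Lemma dual_comb a s t : dual s -> dual t -> dual (fun x => a * s x + t x).
Proof.
move=> ds dt; split; last split.
- by move=> x y; rewrite !dualD//; ring.
- by move=> b x; rewrite !dualZ//; ring.
- case: ds dt => [_ [_ cs]] [_ [_ ct]] x.
  by apply: cvgD; [apply: cvgM; [exact: cvg_cst|exact: cs]|exact: ct].
Qed.

Lemma dual_scale a s : dual s -> dual (fun x => a * s x).
Proof.
move=> ds; have -> : (fun x => a * s x) = (fun x => a * s x + 0).
  by apply/funext => x; rewrite addr0.
exact: dual_comb ds dual_cst0.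
Qed.

Lemma dual_lincomb n (a : nat -> K) (s : nat -> X -> K) : (forall i, dual (s i)) ->
  dual (fun x => \sum_(i < n) a i * s i x).
Proof.
move=> ds; elim: n => [|n IH].
  by under eq_fun do rewrite big_ord0; exact: dual_cst0.
by under eq_fun do rewrite big_ord_recr /= addrC; exact: dual_comb.
Qed.

Lemma polarP U s : polar U s <-> dual s /\ forall A, U A -> nm (s A) <= 1.
Proof.
by split=> -[ds sU]; split=> // A /sU; rewrite -(nm_le S) (rho1 S).
Qed.

(** A positive radius in [K] equals its own modulus, so real radii give the same neighbourhoods. *)
Lemma wclosureP C s : wclosure C s <-> dual s /\
  forall n (A : nat -> X) e, 0 < e ->
    exists2 t, C t & forall i, (i < n)%N -> nm (t (A i) - s (A i)) < e.
Proof.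
split=> -[ds h]; split=> // n A e e0.
  have /(h n A)[t [Ct tA]] : 0 < rho e by rewrite -(rho0 S) (ltr_rho S).
  by exists t => // i /tA; rewrite (nm_lt S).
have eE : e = rho (nm e) by rewrite -(normE S) gtr0_norm.
have /(h n A)[t Ct tA] : 0 < nm e by rewrite -(ltr_rho S) (rho0 S) -eE.
by exists t; split=> // i /tA; rewrite [X in _ -> _ < X]eE (nm_lt S).
Qed.

(** [M] bounds the support function of the polar at [A]. This replaces the gauge of [U], as [U] need
    not be convex. *)
Definition polar_bound U A (M : R) := forall s, polar U s -> nm (s A) <= M.

Lemma polar_bound1 U A : U A -> polar_bound U A 1.
Proof. by move=> UA s /polarP[_]; exact. Qed.

(** Scalar multiplication is continuous at [(0, A)], so a small multiple of [A] lies in [U]. *)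
Lemma polar_bounded U A : nbhs 0 U -> exists2 M, 0 <= M & polar_bound U A M.
Proof.
move=> U0.
have : {for (0 : K^o, A), continuous (fun z : K^o * X =>
  z.1 *: z.2)} by exact: scale_continuous.
move=> /(_ U); rewrite /= scale0r => /(_ U0) -[[V W] /= [V0 WA] VWU].
have [d /= d0 dV] : exists2 d : K, 0 < d & forall a : K, `|a| < d -> V a.
  move: V0 => /nbhs_ballP[d /= d0 dV]; exists d => // a ad; apply: dV.
  by rewrite /ball /= sub0r normrN.
have Ud : U ((d / 2) *: A).
  apply: (VWU (d / 2, A)); split => /=; last exact: nbhs_singleton.
  by apply: dV; rewrite gtr0_norm ?divr_gt0// ltr_pdivrMr// ltr_pMr// ltr1n.
have d20 : d / 2 != 0 by rewrite gt_eqF// divr_gt0.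
exists (nm (d / 2)^-1) => [|s /polarP[ds /(_ _ Ud)]]; first exact: (nm_ge0 S).
rewrite dualZ// => h.
rewrite -[s A](mulKf d20) (nmM S) -[leRHS]mulr1 ler_wpM2l ?(nm_ge0 S)//.
Qed.

Lemma polar_bounded_seq U (A : nat -> X) n : nbhs 0 U ->
  exists2 M, 0 <= M & forall i, (i < n)%N -> polar_bound U (A i) M.
Proof.
move=> U0; elim: n => [|n [M M0 IH]]; first by exists 0.
have [M' M'0 M'A] := polar_bounded (A n) U0.
exists (M + M') => [|i]; first by rewrite addr_ge0.
rewrite ltnS leq_eqVlt => /predU1P[->|/IH MA] t pt.
  by rewrite (le_trans (M'A _ pt))// lerDr.
by rewrite (le_trans (MA _ pt))// lerDl.
Qed.

End Dual.

(** * The approximating convex body *)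

Section Body.
Context (R : realType) (K : numFieldType) (re : K -> R) (rho : R -> K)
  (cj : K -> K) (S : scalars re rho cj) (X : topologicalLmodType K).
Local Notation nm z := (re `|z|).
Context (U : set X) (C : set (X -> K)) (v : nat -> X -> K) (B : nat -> X)
  (k : nat) (kappa delta : R) (s0 : X -> K).
(** The weights in [vsmall] are such that coordinates of modulus at most [kappa] contribute at most
    [M * delta] in total from index [k] on. [s0], in the span of the [v j] with [j < k], yields a
    point of the body. *)
Hypotheses (U0 : nbhs 0 U) (CUC : CU U C) (dv : forall i, dual (v i))
  (vB : forall i j, v i (B j) = (i == j)%:R)
  (vsmall : forall m A M, polar_bound re U A M ->
     nm (v (k + m) A) <= M * delta / (kappa * 2 ^+ m.+1))
  (kappa0 : 0 < kappa) (delta0 : 0 < delta) (delta1 : delta < 1)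
  (C_ball : forall s, C s -> \sum_(j < k) nm (s (B j)) ^+ 2 <= kappa ^+ 2)
  (Cs0 : C s0) (s0v : forall A, s0 A = s0 (\sum_(j < k) v j A *: B j)).

Local Notation P n A := (\sum_(j < n) v j A *: B j).

(* All four conditions constrain values [s A] at finitely many vectors at a time, so no
   infinite sum occurs and weak*-closedness is immediate; the last one says that
   [s] is the sum of its coordinate series, with a geometric rate. *)
Definition body : set (X -> K) := [set s | [/\ dual s,
  forall n, \sum_(j < n) nm (s (B j)) ^+ 2 <= kappa ^+ 2,
  C (fun A => rho (1 - delta)^-1 * s (P k A)) &
  forall A M, polar_bound re U A M ->
    forall m, nm (s (A - P (k + m) A)) <= M * delta / 2 ^+ m]].

Definition fcomb (y : nat -> K) n := fun A => \sum_(j < n) y j * v j A.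

Lemma dual_P s n A : dual s -> s (P n A) = fcomb (fun j => s (B j)) n A.
Proof. by move=> ds; rewrite (dual_sum _ (fun j => v j A))//; apply: eq_bigr => i _;
  rewrite mulrC. Qed.

Lemma v_P i n A : v i (P n A) = if (i < n)%N then v i A else 0.
Proof.
rewrite dual_P// /fcomb; case: ifPn => [i_n|].
  rewrite (bigD1 (Ordinal i_n))//= vB eqxx mul1r big1 ?addr0// => j ji.
  by rewrite vB; case: eqP => [ij|_]; rewrite ?mul0r//; move: ji;
    rewrite -val_eqE/= ij eqxx.
rewrite -leqNgt => n_i; apply: big1 => j _.
by rewrite vB gtn_eqF ?mul0r// (leq_trans (ltn_ord j)).
Qed.

Lemma fcomb_dual y n : dual (fcomb y n).
Proof. exact: dual_lincomb. Qed.

Lemma fcomb_B y n j : fcomb y n (B j) = if (j < n)%N then y j else 0.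
Proof.
rewrite /fcomb; case: ifPn => [j_n|].
  rewrite (bigD1 (Ordinal j_n))//= vB eqxx mulr1 big1 ?addr0// => i ij.
  by rewrite vB; case: eqP => [ij'|_]; rewrite ?mulr0//; move: ij;
    rewrite -val_eqE/= ij' eqxx.
rewrite -leqNgt => n_j; apply: big1 => i _.
by rewrite vB ltn_eqF ?mulr0// (leq_trans (ltn_ord i)).
Qed.

Lemma fcomb_P y N n A : (N <= n)%N -> fcomb y N (P n A) = fcomb y N A.
Proof. by move=> Nn; apply: eq_bigr => j _; rewrite v_P (leq_trans (ltn_ord j)). Qed.

Lemma eq_fcomb y y' n : (forall j, (j < n)%N -> y j = y' j) -> fcomb y n = fcomb y' n.
Proof. by move=> yy'; apply/funext => A; apply: eq_bigr => j _; rewrite yy'. Qed.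

Lemma C_dual s : C s -> dual s.
Proof. by move=> Cs; have [_ [_ [_ /(_ _ Cs)[]]]] := CUC. Qed.

Lemma C_polar_bound s A M : C s -> polar_bound re U A M -> nm (s A) <= M.
Proof. by move=> Cs; apply; case: CUC => [_ [_ [_]]]; exact. Qed.

Lemma d1_gt0 : 0 < 1 - delta. Proof. by rewrite subr_gt0. Qed.

Lemma rho_d1V z : rho (1 - delta) * (rho (1 - delta)^-1 * z) = z.
Proof. by rewrite mulrA -(rhoM S) mulfV ?gt_eqF ?d1_gt0// (rho1 S) mul1r. Qed.

Lemma body_head s : body s ->
  exists2 h, C h & forall A, s (P k A) = rho (1 - delta) * h A.
Proof. by move=> [_ _ Ch _]; eexists; [exact: Ch|move=> A /=; rewrite rho_d1V]. Qed.

(** On [U] the head contributes at most [1 - delta], and the tail, by the last condition at [m = 0],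
    at most [delta]. *)
Lemma body_polar s : body s -> polar U s.
Proof.
move=> bs; apply/(polarP S); split=> [|A UA]; first by case: bs.
have [h Ch sh] := body_head bs.
have [ds _ _ /(_ A 1 (polar_bound1 S UA) 0)] := bs.
rewrite addn0 mul1r expr0 divr1 => tail.
rewrite -(subrK (P k A) A) dualD// (le_trans (nmD S _ _))//.
rewrite sh (nmM S) (nm_rho S) ?(ltW d1_gt0)//.
have := C_polar_bound Ch (polar_bound1 S UA).
by have := d1_gt0; nra.
Qed.

Lemma body_closed : wclosed body.
Proof.
move=> s /(wclosureP S)[ds cs]; split => //.
- move=> n; apply/ler_addgt0Pr => e e0.
  (* Changing a coordinate of modulus at most [kappa] by [c <= 1] raises its square by at most
     [c * (2 * kappa + 1)]; [r] keeps [n] such errors below [e]. The last [+ 1] covers [n = 0]. *)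
  pose r := e / (n%:R * (2 * kappa + 1) + 1).
  have den : 0 < n%:R * (2 * kappa + 1) + 1.
    by rewrite ltr_wpDl// mulr_ge0// addr_ge0// mulr_ge0// ltW.
  have k1 : 0 <= 2 * kappa + 1 by rewrite addr_ge0// mulr_ge0// ltW.
  have r0 : 0 < Num.min r 1 by rewrite lt_min ltr01 divr_gt0.
  have [t [_ tk _ _] ts] := cs n B _ r0.
  have le1 (j : 'I_n) : nm (s (B j)) ^+ 2 <= nm (t (B j)) ^+ 2 + r * (2 * kappa + 1).
    have := ts j (ltn_ord j); rewrite lt_min => /andP[tr t1].
    have tkj : nm (t (B j)) <= kappa.
      rewrite -(@ler_pXn2r _ 2) ?nnegrE ?(nm_ge0 S) ?(ltW kappa0)//.
      rewrite (le_trans _ (tk n))// (bigD1 j)//= lerDl sumr_ge0// => i _.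
      by rewrite exprn_ge0 ?(nm_ge0 S).
    have st : nm (s (B j)) <= nm (t (B j)) + nm (t (B j) - s (B j)).
      by rewrite -[X in nm X <= _](subKr (t (B j))) (nmB S).
    have := nm_ge0 S (s (B j)); have := nm_ge0 S (t (B j)).
    have := nm_ge0 S (t (B j) - s (B j)).
    move: (nm (s (B j))) (nm (t (B j))) (nm (t (B j) - s (B j))) tr t1 tkj st.
    move=> a b c *.
    have h : a ^+ 2 <= (b + c) ^+ 2 by rewrite ler_pXn2r ?nnegrE ?addr_ge0.
    have : 2 * b * c + c ^+ 2 <= c * (2 * kappa + 1) by nra.
    have : c * (2 * kappa + 1) <= r * (2 * kappa + 1).
      by rewrite ler_wpM2r ?k1//; apply: ltW.
    by nra.
  apply: le_trans (ler_sum _ (fun j _ => le1 j)) _.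
  rewrite big_split /= lerD ?tk// sumr_const card_ord -[leLHS]mulr_natl.
  rewrite [leLHS](_ : _ = e * (n%:R * (2 * kappa + 1)) / (n%:R * (2 * kappa + 1) + 1)).
    by rewrite ler_pdivrMr// ler_pM2l// lerDl.
  by rewrite /r; field; rewrite gt_eqF.
(* The rescaled head takes at [A i] a multiple of the value of [s] at [P k (A i)], so approximating
   [s] at these vectors approximates its head by points of the closed set [C]. *)
- have [_ [_ [+ _]]] := CUC; apply; apply/(wclosureP S); split.
    by apply: dual_scale; under eq_fun do rewrite dual_P//; exact: fcomb_dual.
  move=> n A e e0.
  have e1 : 0 < (1 - delta) * e by rewrite mulr_gt0// d1_gt0.
  have [t [dt _ Ct _] ts] := cs n (fun i => P k (A i)) _ e1.
  eexists; first exact: Ct.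
  move=> i /ts ti /=; rewrite -mulrBr (nmM S) (nm_rho S) ?invr_ge0 ?(ltW d1_gt0)//.
  by rewrite [ltLHS]mulrC ltr_pdivrMr ?d1_gt0// [ltRHS]mulrC.
- move=> A M MA m; apply/ler_addgt0Pr => e e0.
  have [t [_ _ _ /(_ _ _ MA m) tm] /(_ 0 isT) ts] := cs 1 (fun=> A - P (k + m) A) _ e0.
  rewrite -[X in nm X <= _](subKr (t (A - P (k + m) A))) (le_trans (nmB S _ _))//.
  by rewrite lerD// ltW.
Qed.

Lemma body_convex : convex_dual body.
Proof.
move=> s1 s2 t [d1 n1 h1 t1] [d2 n2 h2 t2] t01.
have [r /andP[r0 r1] tE] := unit_interval_rho S t01.
have r1' : 0 <= 1 - r by rewrite subr_ge0.
have nmc (a b : K) : nm (t * a + (1 - t) * b) <= r * nm a + (1 - r) * nm b.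
  rewrite (le_trans (nmD S _ _))// !(nmM S) tE -(rho1 S) -(rhoB S).
  by rewrite !(nm_rho S).
split.
- exact: dual_comb (dual_scale (1 - t) d2).
- move=> n; apply: (@le_trans _ _ (r * kappa ^+ 2 + (1 - r) * kappa ^+ 2));
  last by rewrite -mulrDl; lra.
  apply: le_trans (lerD (ler_wpM2l r0 (n1 n)) (ler_wpM2l r1' (n2 n))).
  rewrite !mulr_sumr -big_split /=; apply: ler_sum => j _.
  have := nmc (s1 (B j)) (s2 (B j)); have := nm_ge0 S (s1 (B j));
    have := nm_ge0 S (s2 (B j)).
  have := nm_ge0 S (t * s1 (B j) + (1 - t) * s2 (B j)).
  move: (nm (t * _ + _)) (nm (s1 _)) (nm (s2 _)) => a b c a0 c0 b0 abc.
  have : a ^+ 2 <= (r * b + (1 - r) * c) ^+ 2.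
    by rewrite ler_pXn2r ?nnegrE// addr_ge0// mulr_ge0.
  (* This is the defect in the convexity inequality for the square. *)
  have : 0 <= r * (1 - r) * (b - c) ^+ 2 by rewrite mulr_ge0 ?sqr_ge0// mulr_ge0.
  by nra.
- have [_ [cC _]] := CUC.
  have := cC _ _ t h1 h2 t01; congr (C _); apply/funext => A; ring.
- move=> A M MA m; rewrite (le_trans (nmc _ _))//.
  have := t1 _ _ MA m; have := t2 _ _ MA m.
  by move: (nm _) (nm _) (_ / _) => a b c; nra.
Qed.

(** Telescoping: the coordinate of index [k + m + p] costs at most [kappa] times its [vsmall] bound,
    that is [M * delta / 2 ^+ (m + p).+1]. *)
Lemma fcomb_tail y N : (forall j, nm (y j) <= kappa) ->
  forall A M, polar_bound re U A M ->
  forall m, nm (fcomb y N (A - P (k + m) A)) <= M * delta / 2 ^+ m.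
Proof.
move=> yk A M MA m.
pose z j := if (j < N)%N then y j else 0.
have zk j : nm (z j) <= kappa by rewrite /z; case: ifP; rewrite // (nm0 S)// ltW.
have PE n : fcomb y N (P n A) = fcomb z n A.
  rewrite dual_P; last exact: fcomb_dual.
  by rewrite (@eq_fcomb _ z) // => j _; rewrite fcomb_B.
rewrite dualB; last exact: fcomb_dual.
(* [fcomb y N] reads only [N] coordinates, so [A] may be replaced by [P (k + m + N) A], which leaves
   a finite sum. *)
rewrite -(fcomb_P y A (leq_addl (k + m) N)) !PE.
suff part p : nm (fcomb z (k + m + p) A - fcomb z (k + m) A) <=
    M * delta / 2 ^+ m - M * delta / 2 ^+ (m + p).
  apply: le_trans (part N) _;
    rewrite gerBl divr_ge0 ?exprn_ge0// mulr_ge0 ?(ltW delta0)//.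
  (* [M] is nonnegative because it bounds the modulus of [s0 A]. *)
  by rewrite (le_trans (nm_ge0 S (s0 A)))// C_polar_bound.
elim: p => [|p IH]; first by rewrite !addn0 !subrr (nm0 S).
rewrite addnS /fcomb big_ord_recr /= addrAC (le_trans (nmD S _ _))//.
have -> : M * delta / 2 ^+ m - M * delta / 2 ^+ (m + p.+1) =
  (M * delta / 2 ^+ m - M * delta / 2 ^+ (m + p)) + M * delta / 2 ^+ (m + p).+1.
  by rewrite addnS !exprS; field; rewrite ?expf_neq0.
rewrite lerD// (nmM S).
have -> : M * delta / 2 ^+ (m + p).+1 = kappa * (M * delta / (kappa * 2 ^+ (m + p).+1)).
  by field; rewrite ?expf_neq0 ?gt_eqF.
by rewrite ler_pM ?(nm_ge0 S)// -addnA; exact: vsmall.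
Qed.

(** The norm bound keeps each coefficient within [kappa], so [fcomb_tail] supplies the decay; only
    head and norm remain to be checked. *)
Lemma body_fcomb y n h : C h -> (forall A, fcomb y n (P k A) = rho (1 - delta) * h A) ->
  \sum_(j < n) nm (y j) ^+ 2 <= kappa ^+ 2 -> body (fcomb y n).
Proof.
move=> Ch yh yk.
pose z j := if (j < n)%N then y j else 0.
have zk i : \sum_(j < i) nm (z j) ^+ 2 <= kappa ^+ 2.
  apply: le_trans yk; apply: le_trans (@sum_support_le _ (fun j =>
    nm (z j) ^+ 2) n i _ _) _.
  - by move=> j; rewrite exprn_ge0 ?(nm_ge0 S).
  - by move=> j nj; rewrite /z ltnNge nj/= (nm0 S)// expr0n.
  - by apply: ler_sum => j _; rewrite /z ltn_ord.
split.
- exact: fcomb_dual.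
- by move=> i; under eq_bigr do rewrite fcomb_B; exact: zk.
- have -> // : (fun A => rho (1 - delta)^-1 * fcomb y n (P k A)) = h.
  apply/funext => A; rewrite yh mulrA -(rhoM S) mulVf ?gt_eqF ?d1_gt0//.
  by rewrite (rho1 S) mul1r.
- rewrite (@eq_fcomb y z) => [|j jn]; last by rewrite /z jn.
  apply: fcomb_tail => j; rewrite -(@ler_pXn2r _ 2) ?nnegrE ?(nm_ge0 S) ?(ltW kappa0)//.
  rewrite (le_trans _ (zk j.+1))// big_ord_recr/= lerDr sumr_ge0// => i _.
  by rewrite exprn_ge0 ?(nm_ge0 S).
Qed.

(** The first [n] coordinates exhaust the norm, so the later ones vanish; the tail rate makes [t]
    the sum of its coordinates. *)
Lemma body_eq_fcomb t y n : body t -> (forall j, (j < n)%N -> t (B j) = y j) ->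
  \sum_(j < n) nm (y j) ^+ 2 = kappa ^+ 2 -> t = fcomb y n.
Proof.
move=> [dt tk _ tt] ty yk.
have t0 j : (n <= j)%N -> t (B j) = 0.
  move=> nj; apply: (nm_eq0 S); apply/eqP; rewrite -sqrf_eq0 eq_le sqr_ge0 andbT.
  suff : kappa ^+ 2 <= \sum_(i < j) nm (t (B i)) ^+ 2.
    by have := tk j.+1; rewrite big_ord_recr /=; lra.
  rewrite -yk (eq_bigr (fun i : 'I_n => nm (t (B i)) ^+ 2)) => [|i _]; last by rewrite ty.
  rewrite -!(big_mkord xpredT (fun i => nm (t (B i)) ^+ 2)) (big_cat_nat (leq0n n) nj) /=.
  by rewrite lerDl sumr_ge0// => i _; rewrite exprn_ge0 ?(nm_ge0 S).
apply/funext => A; apply/eqP; rewrite -subr_eq0; apply/eqP/(nm_eq0 S).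
apply/le_anti; rewrite (nm_ge0 S) andbT leNgt; apply/negP => e0.
have [M M0 MA] := polar_bounded S A U0.
(* Adding [n] puts the cutoff [k + (m0 + n)] past every coordinate used by [fcomb y n]. *)
have [m0 /(_ (m0 + n)%N (leq_addr _ _)) small] := geometric_small (M * delta) e0.
move: small; rewrite ltNge => /negP; apply; have := tt _ _ MA (m0 + n)%N.
rewrite dualB// [in t (\sum_(_ < _) _)]dual_P//; congr (nm (_ - _) <= _); rewrite addnA.
rewrite -[RHS](fcomb_P y A (leq_addl (k + m0) n)) dual_P; last exact: fcomb_dual.
congr (_ A); apply: eq_fcomb => j _; rewrite fcomb_B; case: ifPn; first exact: ty.
by rewrite -leqNgt => /t0.
Qed.

(* Strict convexity of the Hilbert ball, from 2 Re <t, y> = |t|^2 + |y|^2 - |t - y|^2. *)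
Lemma fcomb_exposed y n : body (fcomb y n) -> \sum_(j < n) nm (y j) ^+ 2 = kappa ^+ 2 ->
  exposed re body (fcomb y n).
Proof.
(* Evaluation at this vector is the inner product with [y] in the coordinates [u (B j)]. *)
move=> bf yk; split=> //; exists (\sum_(j < n) cj (y j) *: B j) => t bt tne.
have key u : dual u -> 2 * re (u (\sum_(j < n) cj (y j) *: B j)) =
    \sum_(j < n) nm (u (B j)) ^+ 2 + \sum_(j < n) nm (y j) ^+ 2
    - \sum_(j < n) nm (u (B j) - y j) ^+ 2.
  move=> du; rewrite (dual_sum _ (fun j => cj (y j)))// (re_sum S _ (fun j =>
    cj (y j) * u (B j))).
  rewrite mulr_sumr -big_split -sumrB /=.
  by apply: eq_bigr => j _; exact: re_polar S _ _.
rewrite -(@ltr_pM2l _ 2)// !key; [|exact: fcomb_dual|by case: bt].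
have -> : \sum_(j < n) nm (fcomb y n (B j)) ^+ 2 = kappa ^+ 2.
  by rewrite -yk; apply: eq_bigr => j _; rewrite fcomb_B ltn_ord.
have -> : \sum_(j < n) nm (fcomb y n (B j) - y j) ^+ 2 = 0.
  by apply: big1 => j _; rewrite fcomb_B ltn_ord subrr (nm0 S) expr0n.
rewrite yk.
have [_ /(_ n) tk _ _] := bt.
(* By [key] twice the gap is at least the squared distance from [t] to [y]; were that zero,
   [body_eq_fcomb] would identify [t] with the candidate point. *)
suff : 0 < \sum_(j < n) nm (t (B j) - y j) ^+ 2 by move: tk; lra.
have ge0 (j : 'I_n) : true ->
  0 <= nm (t (B j) - y j) ^+ 2 by rewrite exprn_ge0 ?(nm_ge0 S).
rewrite lt_neqAle sumr_ge0// andbT eq_sym psumr_neq0//.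
apply: contra_notT tne => /hasPn none; apply: body_eq_fcomb => // j jn.
have := none (Ordinal jn) (mem_index_enum _); rewrite /= -leNgt => le0.
apply/eqP; rewrite -subr_eq0; apply/eqP/(nm_eq0 S)/eqP.
by rewrite -sqrf_eq0 eq_le le0 sqr_ge0.
Qed.

Lemma body_exposed_dense : body `<=` wclosure (exposed re body).
Proof.
move=> s bs; apply/(wclosureP S); split=> [|n A e e0]; first by case: bs.
have [ds sk _ st] := bs; have [h Ch sh] := body_head bs.
have [M M0 MA] := polar_bounded_seq S A n U0.
(* Truncating and adding the new coordinate cost at most [M * delta / 2 ^+ m] each, whence the
   factor [2]. *)
have [m /(_ m (leqnn _)) small] := geometric_small (2 * M * delta) e0.
(* [r] is the squared norm that the truncation lacks to reach the sphere. Its root goes to index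
   [k + m], which is at least [k], so the head is unchanged. *)
pose r := kappa ^+ 2 - \sum_(j < k + m) nm (s (B j)) ^+ 2.
have r0 : 0 <= r by rewrite subr_ge0.
pose y j := if (j < k + m)%N then s (B j) else rho (Num.sqrt r).
have ys : \sum_(j < k + m) nm (y j) ^+ 2 = \sum_(j < k + m) nm (s (B j)) ^+ 2.
  by apply: eq_bigr => j _; rewrite /y ltn_ord.
have yk : \sum_(j < (k + m).+1) nm (y j) ^+ 2 = kappa ^+ 2.
  by rewrite big_ord_recr /= {2}/y ltnn (nm_rho S) ?sqrtr_ge0// sqr_sqrtr// /r ys addrC
    subrK.
have bf : body (fcomb y (k + m).+1).
  apply: (@body_fcomb _ _ h) => [//||]; last by rewrite yk.
  move=> A'; rewrite dual_P; last exact: fcomb_dual.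
  rewrite -sh dual_P//; congr (_ A'); apply: eq_fcomb => j jk.
  have jkm : (j < k + m)%N by rewrite (leq_trans jk) ?leq_addr.
  by rewrite fcomb_B ltnS ltnW// /y jkm.
exists (fcomb y (k + m).+1); first exact: fcomb_exposed.
move=> i i_n; have MAi := MA _ i_n.
have yE : fcomb y (k + m).+1 (A i) = s (\sum_(j < k + m) v j (A i) *: B j)
    + rho (Num.sqrt r) * v (k + m) (A i).
  rewrite dual_P// /fcomb big_ord_recr /= {2}/y ltnn; congr (_ + _).
  by apply: eq_bigr => j _; rewrite /y ltn_ord.
rewrite yE; have := st _ _ MAi m; rewrite dualB// => tail.
have rk : Num.sqrt r <= kappa.
  rewrite -(@ler_pXn2r _ 2) ?nnegrE ?sqrtr_ge0 ?(ltW kappa0)// sqr_sqrtr//.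
  by rewrite /r gerBl sumr_ge0// => j _; rewrite exprn_ge0 ?(nm_ge0 S).
have far : nm (rho (Num.sqrt r) * v (k + m) (A i)) <= M * delta / 2 ^+ m.
  rewrite (nmM S) (nm_rho S) ?sqrtr_ge0//.
  apply: le_trans (ler_pM _ _ rk (vsmall m MAi)) _; rewrite ?sqrtr_ge0 ?(nm_ge0 S)//.
  rewrite [leLHS](_ : _ = M * delta / 2 ^+ m * 2^-1); last first.
    by rewrite exprS; field; rewrite ?expf_neq0 ?gt_eqF.
  have : 0 <= M * delta / 2 ^+ m by rewrite divr_ge0 ?exprn_ge0// mulr_ge0// ltW.
  by move: (M * delta / _) => c; lra.
rewrite addrAC (le_lt_trans (nmD S _ _))// -(nmN _ (_ - _)) opprB.
apply: le_lt_trans (lerD tail far) _.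
by move: small; lra.
Qed.

(** Such an [h] has no coordinates past the head, the factor cancels in the head condition, and
    [C_ball] gives the norm. This places the shrunken net in the body. *)
Lemma body_shrink h : C h -> (forall A, h A = h (P k A)) -> body (fun A =>
  rho (1 - delta) * h A).
Proof.
move=> Ch hv; have dh := C_dual Ch.
have hE : (fun A => rho (1 - delta) * h A) = fcomb (fun j => rho (1 - delta) * h (B j)) k.
  by apply/funext => A; rewrite hv dual_P// /fcomb mulr_sumr; apply: eq_bigr => j _;
    rewrite mulrA.
rewrite hE; apply: (body_fcomb Ch) => [A|]; first by rewrite -hE /= -hv.
apply: le_trans (C_ball Ch); apply: ler_sum => j _.
rewrite (nmM S) (nm_rho S) ?(ltW d1_gt0)// ler_pXn2r ?nnegrE ?mulr_ge0 ?(nm_ge0 S)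
  ?(ltW d1_gt0)//.
by rewrite ler_piMl ?(nm_ge0 S)// gerBl ltW.
Qed.

Lemma body_CU : CU U body.
Proof.
split; last split; [|exact: body_convex|split; [exact: body_closed|exact: body_polar]].
by eexists; exact: body_shrink Cs0 s0v.
Qed.

Lemma shrink_near h A M : C h -> polar_bound re U A M ->
  nm (h A - rho (1 - delta) * h A) <= M * delta.
Proof.
move=> Ch MA; rewrite (rhoB S) (rho1 S) mulrBl mul1r subKr (nmM S) (nm_rho S) ?(ltW
  delta0)//.
by rewrite mulrC ler_wpM2r ?(ltW delta0)// C_polar_bound.
Qed.

(** [h] is the rescaled head of [s]: dropping the tail and undoing the shrinking cost at most
    [M * delta] each. *)
Lemma body_near s A M : body s -> polar_bound re U A M ->
  exists2 h, C h & nm (h A - s A) <= 2 * M * delta.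
Proof.
move=> bs MA; have [h Ch sh] := body_head bs; exists h => //.
have [ds _ _ /(_ _ _ MA 0)] := bs; rewrite addn0 expr0 divr1 dualB// sh => tail.
have -> : h A - s A = (h A - rho (1 - delta) * h A) - (s A - rho (1 - delta) * h A) by
  ring.
by rewrite (le_trans (nmB S _ _))//; have := shrink_near Ch MA; lra.
Qed.

Lemma body_D0U : D0U re U body.
Proof.
split; first exact: body_CU.
apply/seteqP; split; first exact: body_exposed_dense.
by move=> s [ds h]; apply: body_closed; split=> // n A e /(h n A)[t [[bt _] tA]];
  exists t.
Qed.

End Body.

(** * Exposed points, extreme points and Hausdorff distance *)

(** [re (s A)] is a proper average of two values that do not exceed it, so both equal it, and
    uniqueness of the maximiser gives [s1 = s = s2]. *)
Lemma exposed_extreme (R : realType) (K : numFieldType) (re : K -> R) (rho : R -> K)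
    (cj : K -> K) (S : scalars re rho cj) (X : topologicalLmodType K) (C : set (X -> K)) :
  exposed re C `<=` extreme C.
Proof.
move=> s [Cs [A sA]]; split=> // s1 s2 t Cs1 Cs2 /andP[t0 t1] sE.
have [r _ tE] : exists2 r, 0 <= r <= 1 & t = rho r.
  by apply: (unit_interval_rho S); rewrite !ltW.
move: t0 t1; rewrite tE -(rho0 S) -(rho1 S) !(ltr_rho S) => r0 r1.
have sAE : re (s A) = r * re (s1 A) + (1 - r) * re (s2 A).
  by rewrite {1}sE (reD S) tE -(rho1 S) -(rhoB S) !(re_rhoM S).
have le u : C u -> re (u A) <= re (s A).
  by move=> Cu; have [->//|us] := pselect (u = s); exact/ltW/sA.
have E u : C u -> re (s A) <= re (u A) -> u = s.
  by move=> Cu; apply: contraPP => us; apply/negP; rewrite -ltNge; exact: sA.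
have d1 : 0 <= re (s A) - re (s1 A) by rewrite subr_ge0 le.
have d2 : 0 <= re (s A) - re (s2 A) by rewrite subr_ge0 le.
have : r * (re (s A) - re (s1 A)) + (1 - r) * (re (s A) - re (s2 A)) == 0.
  by apply/eqP; move: sAE; lra.
have r0' : 0 <= r * (re (s A) - re (s1 A)) by rewrite mulr_ge0// ltW.
have r1' : 0 <= (1 - r) * (re (s A) - re (s2 A)) by rewrite mulr_ge0// subr_ge0 ltW.
rewrite paddr_eq0//.
rewrite !mulf_eq0 (gt_eqF r0) [1 - r == 0]subr_eq0 (gt_eqF r1) !orFb !subr_eq0 =>
  /andP[/eqP e1 /eqP e2].
have -> : s1 = s by apply: E; rewrite // e1.
by apply/esym/E; rewrite // e2.
Qed.

(** The closure of the extreme points lies between that of the exposed points, which is [C], and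
    that of [C], which is [C] again. *)
Lemma dense_exposed_DU (R : realType) (K : numFieldType) (re : K -> R) (rho : R -> K)
    (cj : K -> K) (S : scalars re rho cj) (X : topologicalLmodType K) (U : set X) :
  D0U re U `<=` DU U.
Proof.
move=> C [CUC CE]; split=> //; have [_ [_ [cC _]]] := CUC.
apply/seteqP; split.
  rewrite {1}CE => s [ds h]; split=> // n A e /(h n A)[t [Et tA]].
  by exists t; split=> //; exact: exposed_extreme S _ _ _ Et.
by move=> s [ds h]; apply: cC; split=> // n A e /(h n A)[t [[Ct _] tA]]; exists t.
Qed.

(** The gap between [r] and [e] absorbs the suprema, which keep only weak inequalities. *)
Lemma dH_lt (R : realType) (K : numFieldType) (re : K -> R) (X : topologicalLmodType K)
    (A : X) (F G : set (X -> K)) (r e : R) : r < e ->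
  (forall s, F s -> exists2 t, G t & re `|s A - t A| <= r) ->
  (forall t, G t -> exists2 s, F s & re `|s A - t A| <= r) ->
  (dH re A F G < e%:E)%E.
Proof.
move=> re' FG GF; apply: (@le_lt_trans _ _ r%:E); last by rewrite lte_fin.
rewrite /dH ge_max; apply/andP; split; apply: ge_ereal_sup => _ [s Fs <-].
  have [t Gt st] := FG s Fs; apply: ge_ereal_inf; exists (re `|s A - t A|)%:E;
    [by exists t|].
  by rewrite lee_fin.
have [t Gt st] := GF s Fs; apply: ge_ereal_inf; exists (re `|t A - s A|)%:E;
  [by exists t|].
by rewrite lee_fin.
Qed.

(** * Biorthogonal systems *)

Section Biorthogonal.
Context (R : realType) (K : numFieldType) (re : K -> R) (rho : R -> K)
  (cj : K -> K) (S : scalars re rho cj) (X : topologicalLmodType K) (U : set X).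
Implicit Types (s t w : X -> K) (v : nat -> X -> K) (B : nat -> X) (c : R).
Local Notation nm z := (re `|z|).

Definition bounded_on s M := forall A, U A -> nm (s A) <= M.

Definition bdual s := dual s /\ exists M, bounded_on s M.

Lemma bdual_comb a s t : bdual s -> bdual t -> bdual (fun x => a * s x + t x).
Proof.
move=> [ds [M sM]] [dt [N tN]]; split; first exact: dual_comb.
exists (nm a * M + N) => A UA; rewrite (le_trans (nmD S _ _))// lerD ?tN//.
by rewrite (nmM S) ler_wpM2l ?(nm_ge0 S)// sM.
Qed.

Lemma bdual0 : bdual (fun=> 0).
Proof. by split; [exact: dual_cst0|exists 0 => A _; rewrite (nm0 S)]. Qed.

Lemma bdual_lincomb n (a : nat -> K) v : (forall i, bdual (v i)) ->
  bdual (fun x => \sum_(i < n) a i * v i x).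
Proof.
move=> bv; elim: n => [|n IH].
  by under eq_fun do rewrite big_ord0; exact: bdual0.
by under eq_fun do rewrite big_ord_recr /= addrC; exact: bdual_comb.
Qed.

(** For a biorthogonal system this projects onto the span of the [B j] along the common kernel of
    the [v j]; [s x = s (proj v B k x)] for all [x] then means that [s] lies in the span of the
    [v j], [j < k]. *)
Definition proj v B k A := \sum_(j < k) v j A *: B j.

Definition biorth v B k := forall i j, (i < k)%N -> (j < k)%N -> v i (B j) = (i == j)%:R.

Definition upd T (f : nat -> T) k (a : T) i := if i == k then a else f i.

Lemma upd_same T (f : nat -> T) k a : upd f k a k = a.
Proof. by rewrite /upd eqxx. Qed.

Lemma upd_lt T (f : nat -> T) k a i : (i < k)%N -> upd f k a i = f i.
Proof. by move=> ik; rewrite /upd ltn_eqF. Qed.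

Lemma proj_B v B k i : biorth v B k -> (i < k)%N -> proj v B k (B i) = B i.
Proof.
move=> vB ik; rewrite /proj (bigD1 (Ordinal ik))//= vB// eqxx scale1r big1 ?addr0// =>
  j ji.
by rewrite vB//; move: ji; rewrite -val_eqE/= => /negPf ->; rewrite scale0r.
Qed.

Lemma v_proj v B k i A : biorth v B k -> dual (v i) -> (i < k)%N ->
  v i (proj v B k A) = v i A.
Proof.
move=> vB di ik; rewrite /proj (dual_sum _ (fun j => v j A))//.
rewrite (bigD1 (Ordinal ik))//= vB// eqxx mulr1 big1 ?addr0// => j ji.
by rewrite vB//; move: ji; rewrite -val_eqE/= eq_sym => /negPf ->; rewrite mulr0.
Qed.

Lemma proj_upd v B k w b A :
  proj (upd v k w) (upd B k b) k.+1 A = proj v B k A + w A *: b.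
Proof.
rewrite /proj big_ord_recr /= !upd_same; congr (_ + _).
by apply: eq_bigr => i _; rewrite !upd_lt.
Qed.

(** A Gram-Schmidt step: [s'] is [s] minus its part in the span, [b] comes from [x0] minus its
    projection, scaled so that [w b = 1]. Scaling [w] down is offset by scaling [b] up, so any [c]
    can be met. *)
Lemma biorth_extend v B k s c : (forall i, bdual (v i)) -> biorth v B k ->
  bdual s -> 0 < c -> (exists x, s x <> s (proj v B k x)) ->
  exists w b, [/\ bdual w, bounded_on w c, biorth (upd v k w) (upd B k b) k.+1,
    (forall i, (i < k)%N -> v i b = 0) &
    forall x, s x = s (proj (upd v k w) (upd B k b) k.+1 x)].
Proof.
move=> bv vB bs c0 [x0 sx0]; have ds := bs.1; have dv i := (bv i).1.
pose s' x := -1 * (\sum_(i < k) s (B i) * v i x) + s x.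
have s'E x : s' x = s x - s (proj v B k x).
  rewrite /s' /proj (dual_sum _ (fun j => v j x))// mulN1r addrC; congr (_ - _).
  by apply: eq_bigr => i _; rewrite mulrC.
have bs' : bdual s' by apply: bdual_comb bs; exact: (@bdual_lincomb k (fun i => s (B i))).
have [ds' [M s'M]] := bs'.
have s'x0 : s' x0 != 0 by rewrite s'E subr_eq0; apply/eqP.
have M1 : 0 < `|M| + 1 by rewrite ltr_wpDl.
pose a := rho (c / (`|M| + 1)).
have a0 : a != 0 by rewrite -(rho0 S) (inj_eq (rho_inj S)) mulf_neq0 ?invr_eq0 ?gt_eqF.
pose w x := a * s' x.
pose b := (a * s' x0)^-1 *: (x0 - proj v B k x0).
have vb i : (i < k)%N -> v i b = 0.
  by move=> ik; rewrite dualZ// dualB// v_proj// subrr mulr0.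
have projb : proj v B k b = 0.
  by rewrite /proj big1// => i _; rewrite vb// scale0r.
have sb : s b = a^-1.
  by rewrite dualZ// dualB// -s'E invfM divfK.
have wB i : (i < k)%N -> w (B i) = 0.
  by move=> ik; rewrite /w s'E proj_B// subrr mulr0.
have wb : w b = 1 by rewrite /w s'E projb (dual0 ds) subr0 sb mulfV.
exists w, b; split=> //.
- have -> : w = fun x => a * s' x + 0 by apply/funext => x; rewrite addr0.
  by apply: bdual_comb; last exact: bdual0.
- move=> A UA; rewrite /w (nmM S) (nm_rho S) ?divr_ge0 ?(ltW c0) ?(ltW M1)//.
  rewrite mulrAC ler_pdivrMr// ler_pM2l// (le_trans (s'M _ UA))//.
  by rewrite (le_trans (ler_norm _))// lerDl.
- move=> i j; rewrite !ltnS leq_eqVlt => /predU1P[->|ik].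
    rewrite leq_eqVlt => /predU1P[->|jk]; first by rewrite !upd_same eqxx.
    by rewrite upd_same upd_lt// wB// gtn_eqF.
  rewrite leq_eqVlt => /predU1P[->|jk]; rewrite upd_lt//.
    by rewrite upd_same vb// ltn_eqF.
  by rewrite upd_lt// vB.
- by move=> x; rewrite proj_upd dualD// dualZ// sb /w mulrAC mulfV// mul1r s'E addrC
  subrK.
Qed.

(** The system grows only at those [g n] outside the current span, so the [g i] may be linearly
    dependent. *)
Lemma finite_biorth (g : nat -> X -> K) n : (forall i, bdual (g i)) ->
  exists k v B, [/\ forall i, bdual (v i), biorth v B k &
    forall i, (i < n)%N -> forall x, g i x = g i (proj v B k x)].
Proof.
move=> bg; elim: n => [|n [k [v [B [bv vB gE]]]]].
  by exists 0, (fun _ _ => 0), (fun=> 0); split=> // i; exact: bdual0.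
have [gn|/existsNP ngn] := pselect (forall x, g n x = g n (proj v B k x)).
  exists k, v, B; split=> // i; rewrite ltnS leq_eqVlt => /predU1P[-> //|]; exact: gE.
have [w [b [bw _ vB' vb gn]]] := biorth_extend bv vB (bg n) ltr01 ngn.
exists k.+1, (upd v k w), (upd B k b); split=> //.
  by move=> i; rewrite /upd; case: ifP.
move=> i; rewrite ltnS leq_eqVlt => /predU1P[-> //|i_n] x.
(* An earlier [g i] vanishes at [b], because the old projection kills [b]. *)
have dg := (bg i).1; rewrite proj_upd dualD// dualZ// (gE i i_n b).
rewrite /proj [\sum_(j < k) v j b *: _]big1 => [|j _]; last by rewrite vb// scale0r.
by rewrite (dual0 dg) mulr0 addr0; exact: gE.
Qed.

(** Otherwise every [sigma n] is determined by its values at [k] vectors; a linear relation between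
    [k.+1] rows of such values then holds between the functionals. *)
Lemma lin_indep_not_spanned (sigma : nat -> X -> K) v B k :
  (forall i, dual (sigma i)) -> lin_indep_seq sigma ->
  exists n, exists x, sigma n x <> sigma n (proj v B k x).
Proof.
move=> dsig ind; apply: contrapT => /forallNP h.
have sE n x : sigma n x = sigma n (proj v B k x).
  by apply: contrapT => nx; apply: (h n); exists x.
pose M : 'M[K]_(k.+1, k) := \matrix_(i, j) sigma i (B j).
have : kermx M != 0.
  by rewrite -mxrank_eq0 mxrank_ker subn_eq0 -ltnNge ltnS rank_leq_col.
move=> /rowV0Pn[c /sub_kermxP cM c0]; case/negP: c0; apply/eqP/rowP => i; rewrite mxE.
have := ind k.+1 (fun j => c 0 (inord j)) _ i (ltn_ord i); rewrite inord_val; apply=> x.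
under eq_bigr => j _.
  rewrite sE /proj (dual_sum _ (fun j => v j x))// mulr_sumr inord_val.
  over.
rewrite exchange_big /= big1// => l _.
have /rowP/(_ l) := cM; rewrite !mxE => cMl.
transitivity (v l x * \sum_j c 0 j * M j l); last by rewrite cMl mulr0.
rewrite mulr_sumr; apply: eq_bigr => j _.
by rewrite !mxE; ring.
Qed.

(** Some [sigma n] always leaves the current span, so extension can be iterated, with bound [c m] at
    step [m]. Stages only append, so a diagonal gives the limit. *)
Lemma infinite_biorth (sigma : nat -> X -> K) v0 B0 k (c : nat -> R) :
  (forall i, bdual (sigma i)) -> lin_indep_seq sigma ->
  (forall i, bdual (v0 i)) -> biorth v0 B0 k -> (forall m, 0 < c m) ->
  exists v B, [/\ forall i, bdual (v i), forall i j, v i (B j) = (i == j)%:R,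
    forall i, (i < k)%N -> v i = v0 i /\ B i = B0 i &
    forall m, bounded_on (v (k + m)%N) (c m)].
Proof.
move=> bsig ind bv0 vB0 c0.
pose state := ((nat -> X -> K) * (nat -> X))%type.
pose ok m (q : state) := (forall i, bdual (q.1 i)) /\ biorth q.1 q.2 (k + m).
pose step m (q q' : state) := [/\ ok m.+1 q',
  forall i, (i < k + m)%N -> q'.1 i = q.1 i /\ q'.2 i = q.2 i &
  bounded_on (q'.1 (k + m)%N) (c m)].
(* The implication lets choice produce a step function defined on all states, valid or not. *)
have /choice[F FP] (mq : nat * state) : exists q', ok mq.1 mq.2 -> step mq.1 mq.2 q'.
  case: mq => m [v B] /=; have [[/= bv vB]|nok] := pselect (ok m (v, B));
    last by exists (v, B).
  have [n nx] := lin_indep_not_spanned v B (k + m) (fun i => (bsig i).1) ind.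
  have [w [b [bw wc vB' _ _]]] := biorth_extend bv vB (bsig n) (c0 m) nx.
  exists (upd v (k + m) w, upd B (k + m) b) => _; split.
  - by split=> /=; [move=> i; rewrite /upd; case: ifP|rewrite addnS].
  - by move=> i ik /=; rewrite !upd_lt.
  - by rewrite /= upd_same.
pose st := fix st m := if m is m'.+1 then F (m', st m') else (v0, B0).
have ok_st m : ok m (st m).
  elim: m => [|m IH]; first by split=> //=; rewrite addn0.
  by have [] := FP (m, st m) IH.
have step_st m : step m (st m) (st m.+1) by exact: FP (m, st m) (ok_st m).
have stable m p i : (i < k + m)%N ->
  (st (m + p)%N).1 i = (st m).1 i /\ (st (m + p)%N).2 i = (st m).2 i.
  move=> ikm; elim: p => [|p [IH1 IH2]]; first by rewrite addn0.
  have [_ /(_ i)] := step_st (m + p)%N; rewrite addnA (leq_trans ikm) ?leq_addr//.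
  by move=> /(_ isT)[e1 e2] _; rewrite addnS e1 e2.
(* Entry [i] is final from stage [i.+1] on, because [i < k + i.+1]. *)
pose v i := (st i.+1).1 i; pose B i := (st i.+1).2 i.
have vE m i : (i < k + m)%N -> v i = (st m).1 i /\ B i = (st m).2 i.
  move=> ikm; have [e1 e2] := stable m i.+1 i ikm.
  have iki : (i < k + i.+1)%N by rewrite addnS ltnS leq_addl.
  have [e3 e4] := stable i.+1 m i iki.
  by rewrite /v /B -e3 -e4 addnC e1 e2.
exists v, B; split.
- by move=> i; have [h _] := ok_st i.+1; exact: h.
- move=> i j; pose m := (i + j).+1.
  have ikm : (i < k + m)%N by rewrite /m addnS ltnS (leq_trans (leq_addr j i)) ?leq_addl.
  have jkm : (j < k + m)%N by rewrite /m addnS ltnS (leq_trans (leq_addl i j)) ?leq_addl.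
  by rewrite (vE m i ikm).1 (vE m j jkm).2; have [_] := ok_st m; exact.
- by move=> i ik; apply: (vE 0); rewrite addn0.
- move=> m; rewrite (vE m.+1 _ _).1 ?addnS//; by have [] := step_st m.
Qed.

End Biorthogonal.

(** * Finite nets and the choice of constants *)

Section Density.
Context (R : realType) (K : numFieldType) (re : K -> R) (rho : R -> K)
  (cj : K -> K) (S : scalars re rho cj) (X : topologicalLmodType K) (U : set X).
Hypothesis U0 : nbhs 0 U.
Local Notation nm z := (re `|z|).

(** Points are coded by the cells of their values at the [A l]; codes are finite in number, and one
    point per attained code forms the net. *)
Lemma finite_net (C : set (X -> K)) (A : nat -> X) n e : C !=set0 -> C `<=` polar U ->
  0 < e -> exists (g : nat -> X -> K) N, (forall i, C (g i)) /\
    forall s, C s -> exists2 i, (i < N)%N & forall l, (l < n)%N ->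
      nm (s (A l) - g i (A l)) < e.
Proof.
move=> [s1 Cs1] CU e0; have [M _ MA] := polar_bounded_seq S A n U0.
have [T [q qP]] := tot_bounded S M e0.
pose code s : {ffun 'I_n -> T} := [ffun l : 'I_n => q (s (A l))].
(* An unattained code gets [s1], which keeps every term of the sequence in [C]. *)
have /choice[rep repP] (c : {ffun 'I_n -> T}) :
    exists s, C s /\ forall s', C s' -> code s' = c -> code s = c.
  have [[s [Cs sc]]|nc] := pselect (exists s, C s /\ code s = c); first by exists s.
  by exists s1; split=> // s' Cs' s'c; case: nc; exists s'.
exists (fun i => rep (nth (code s1) (enum {ffun 'I_n ->
  T}) i)), (size (enum {ffun 'I_n -> T})).
split=> [i|s Cs]; first by case: (repP (nth (code s1) (enum {ffun 'I_n -> T}) i)).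
exists (index (code s) (enum {ffun 'I_n -> T})); first by rewrite index_mem mem_enum.
move=> l ln; rewrite nth_index ?mem_enum//.
have [Cr /(_ _ Cs erefl)/ffunP/(_ (Ordinal ln))] := repP (code s).
by rewrite !ffunE /= => qE; apply: qP => //; apply: MA => //; exact: CU.
Qed.

Lemma hyper_dense_D0U (sigma : nat -> X -> K) : (forall i, bdual re U (sigma i)) ->
  lin_indep_seq sigma -> hyper_dense re U (D0U re U).
Proof.
move=> bsig ind C CUC n A e e0.
have [C0 [_ [_ CsubU]]] := CUC.
have [M M0 MA] := polar_bounded_seq S A n U0.
(* Error budget: [e / 4] for the net plus [M * delta <= e / 4] for shrinking in one direction,
   [2 * M * delta <= e / 2] in the other. *)
have e4 : 0 < e / 4 by rewrite divr_gt0.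
have [g [N [Cg gP]]] := finite_net A n C0 CsubU e4.
have bg i : bdual re U (g i).
  by have /(polarP S)[dg gU] := CsubU _ (Cg i); split=> //; exists 1.
have [k [v0 [B0 [bv0 vB0 gE]]]] := finite_biorth S N bg.
have [M' M'0 M'B] := polar_bounded_seq S B0 k U0.
(* The first summand bounds the squared norms over [C]; adding [1] ensures [kappa <= kappa ^+ 2].
   Only the first [k] vectors enter, and the infinite system keeps them, so [c] may depend on
   [kappa]. *)
pose kappa := k%:R * M' ^+ 2 + 1.
have kappa1 : 1 <= kappa by rewrite lerDr mulr_ge0// sqr_ge0.
have kappa0 : 0 < kappa by rewrite (lt_le_trans ltr01).
pose delta := Num.min (1 / 2) (e / (4 * (M + 1))).
have M1 : 0 < M + 1 by rewrite ltr_wpDl.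
have delta0 : 0 < delta by rewrite lt_min !divr_gt0// mulr_gt0.
have delta1 : delta < 1.
  by apply: (@le_lt_trans _ _ (1 / 2)); [rewrite ge_min lexx|lra].
have Mdelta : M * delta <= e / 4.
  apply: (@le_trans _ _ ((M + 1) * (e / (4 * (M + 1))))).
    by rewrite ler_pM ?(ltW delta0) ?lerDl// ge_min lexx orbT.
  by rewrite [leLHS](_ : _ = e / 4)//; field; rewrite gt_eqF.
pose c m := delta / (kappa * 2 ^+ m.+1).
have c0 m : 0 < c m by rewrite divr_gt0// mulr_gt0// exprn_gt0.
have [v [B [bv vB vv0 vc]]] := infinite_biorth S bsig ind bv0 vB0 c0.
have vsmall m x L : polar_bound re U x L ->
    nm (v (k + m)%N x) <= L * delta / (kappa * 2 ^+ m.+1).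
  move=> xL; have cm : 0 <= (c m)^-1 by rewrite invr_ge0 ltW.
  (* Divided by its bound [c m] on [U], the functional lies in the polar, where [L] applies. *)
  have /xL : polar U (fun y => rho (c m)^-1 * v (k + m)%N y).
    apply/(polarP S); split=> [|y Uy]; first by apply: dual_scale; case: (bv (k + m)%N).
    by rewrite (nmM S) (nm_rho S)// mulrC ler_pdivrMr// mul1r vc.
  by rewrite (nmM S) (nm_rho S)// mulrC ler_pdivrMr// mulrA.
have CB s : C s -> \sum_(j < k) nm (s (B j)) ^+ 2 <= kappa ^+ 2.
  move=> Cs; apply: (@le_trans _ _ kappa); last by rewrite expr2 ler_peMl// ltW.
  apply: (@le_trans _ _ (\sum_(j < k) M' ^+ 2)).
    apply: ler_sum => j _; rewrite ler_pXn2r ?nnegrE ?(nm_ge0 S)//.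
    by rewrite (vv0 j (ltn_ord j)).2; apply: M'B => //; exact: CsubU.
  by rewrite sumr_const card_ord -[_ *+ k]mulr_natl lerDl.
have gv i : (i < N)%N -> forall x, g i x = g i (\sum_(j < k) v j x *: B j).
  move=> iN x; rewrite [LHS](gE i iN x); congr (g i _); apply: eq_bigr => j _.
  by have [-> ->] := vv0 j (ltn_ord j).
have dv i : dual (v i) by case: (bv i).
(* As [C] is nonempty, so is the net; [g i0] serves as [s0]. *)
have [i0 i0N _] : exists2 i, (i < N)%N & True.
  by have [s /gP[i iN _]] := C0; exists i.
exists (body re rho U C v B k kappa delta); split.
  exact: (body_D0U S U0 CUC dv vB vsmall kappa0 delta0 delta1 CB (Cg i0) (gv i0 i0N)).
move=> i i_n; apply: (@dH_lt _ _ _ _ _ _ _ (e / 2)); first lra.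
  move=> s Cs; have [j jN sj] := gP s Cs.
  exists (fun x => rho (1 - delta) * g j x).
    exact: (body_shrink S CUC dv vB vsmall kappa0 delta0 delta1 CB (Cg i0) (Cg j) (gv j
      jN)).
  have := shrink_near S CUC delta0 (Cg j) (MA i i_n); have := sj i i_n => h1 h2.
  have -> : s (A i) - rho (1 - delta) * g j (A i) =
    (s (A i) - g j (A i)) + (g j (A i) - rho (1 - delta) * g j (A i)) by ring.
  by apply: le_trans (nmD S _ _) _; lra.
move=> t bt; have [h Ch ht] := body_near S CUC delta0 delta1 bt (MA i i_n).
by exists h => //; apply: le_trans ht _; rewrite -mulrA; lra.
Qed.

Lemma hyper_dense_sub (D D' : set (set (X -> K))) : D `<=` D' ->
  hyper_dense re U D -> hyper_dense re U D'.
Proof. by move=> DD' dD C CUC n A e e0; have [C' [/DD' ? ?]] := dD C CUC n A e e0;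
  exists C'. Qed.

End Density.

(* Two conjuncts: the case K = R and the case K = C = R[i]. *)
Theorem theorem4p2 :
  (forall (R : realType) (X : topologicalLmodType R),
     hausdorff_space X -> separable X -> dual_separates_points X ->
     forall U : set X, nbhs 0 U ->
     (exists sigma : nat -> X -> R,
        (forall n, dual (sigma n)) /\ lin_indep_seq sigma /\
        (forall n, exists M : R, forall A, U A -> `|sigma n A| <= M)) ->
     hyper_dense (@id R) U (D0U (@id R) U) /\ hyper_dense (@id R) U (DU U))
  /\
  (forall (R : realType) (X : topologicalLmodType R[i]),
     hausdorff_space X -> separable X -> dual_separates_points X ->
     forall U : set X, nbhs 0 U ->
     (exists sigma : nat -> X -> R[i],
        (forall n, dual (sigma n)) /\ lin_indep_seq sigma /\
        (forall n, exists M : R, forall A, U A -> complex.Re `|sigma n A| <= M)) ->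
     hyper_dense (@complex.Re R) U (D0U (@complex.Re R) U) /\
     hyper_dense (@complex.Re R) U (DU U)).
Proof.
split=> R X _ _ _ U U0 [sigma [dsig [ind bsig]]].
  have dD := hyper_dense_D0U (scalarsR R) U0 (fun i => conj (dsig i) (bsig i)) ind.
  by split=> //; apply: hyper_dense_sub dD; exact: dense_exposed_DU (scalarsR R) _ _.
have dD := hyper_dense_D0U (scalarsC R) U0 (fun i => conj (dsig i) (bsig i)) ind.
by split=> //; apply: hyper_dense_sub dD; exact: dense_exposed_DU (scalarsC R) _ _.
Qed.
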